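(* A connected graph $G$ satisfies $\mathrm{vp}^-(G) = \mathrm{vp}(G) = 2$ if and only if $G$ is a cycle. Similarly, a connected graph $G$ satisfies $\mathrm{vp}(G) = 2$ only if $G$ is a cycle or a path of length at least $2$.
   Context: All graphs are finite, undirected and simple (so cycles have at least three vertices). A $u,v$-geodesic is a shortest $u,v$-path. For a vertex $x$ of $G$, a set $S \subseteq V(G)$ is an $x$-position set if for every $y \in S$ no vertex of $S \setminus \{y\}$ lies on any $x,y$-geodesic in $G$. The $x$-position number $p_x(G)$ is the maximum cardinality of an $x$-position set of $G$. Define $\mathrm{vp}(G) = \max_{x \in V(G)} p_x(G)$ and $\mathrm{vp}^-(G) = \min_{x \in V(G)} p_x(G)$. *)

(* Defs.v *)
From mathcomp Require Import all_boot.
From mathcomp Require Import boolp.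

Set Implicit Arguments.
Unset Strict Implicit.
Unset Printing Implicit Defensive.

(* A finite simple graph is a symmetric, irreflexive relation e on a finType. *)

Section Graphs.
Variables (T : finType) (e : rel T).
Implicit Types (x y : T) (p : seq T) (S : {set T}).

Definition simple_graph : Prop := symmetric e /\ irreflexive e.

Definition connected_graph : Prop :=
  0 < #|T| /\ forall x y, connect e x y.

(* As in the path library, the sequence p excludes the starting vertex x: the
   vertices of the path are x :: p and its length is size p. *)
Definition is_path_between x y p : bool :=
  [&& path e x p, uniq (x :: p) & last x p == y].

Definition geodesic x y p : Prop :=
  is_path_between x y p /\
  forall q, is_path_between x y q -> size p <= size q.

Definition position_set x S : Prop :=
  forall y, y \in S ->
  forall p, geodesic x y p ->
  forall z, z \in S :\ y -> z \notin x :: p.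

Definition position_number x : nat :=
  \max_(S : {set T} | `[< position_set x S >]) #|S|.

Definition vp : nat := \max_(x : T) position_number x.

(* Every position number is at most #|T|, so the default value of the iterated
   minimum is harmless as soon as T is nonempty. *)
Definition vp_minus : nat := \big[minn/#|T|]_(x : T) position_number x.

End Graphs.

Definition graph_iso (T U : finType) (e : rel T) (d : rel U) : Prop :=
  exists2 f : T -> U, bijective f & forall x y, d (f x) (f y) = e x y.

(* ordS is the cyclic successor i |-> i + 1 mod n. *)
Definition cycle_rel n : rel 'I_n :=
  fun i j => (j == ordS i) || (i == ordS j).

(* The path with l edges, hence l + 1 vertices. *)
Definition path_rel l : rel 'I_l.+1 :=
  fun i j => (j == i.+1 :> nat) || (i == j.+1 :> nat).

Definition is_cycle (T : finType) (e : rel T) : Prop :=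
  exists2 n, 3 <= n & graph_iso e (@cycle_rel n).

Definition is_path_of_length (T : finType) (e : rel T) l : Prop :=
  graph_iso e (@path_rel l).

(* Main.v *)
(* The neighbours of [x] form an [x]-position set, so [vp = 2] bounds all degrees
   by 2; a longest path then spans the graph, and its only possible chord joins
   its two ends. Conversely, a position set is controlled by separation: a
   geodesic from [x] to [y] enters any set [A] containing [y] but not [x], and it
   does so from a vertex outside the position set. Choosing as [A] an open arc
   bounded by two elements of the position set bounds its size by 2 on a cycle,
   and by 1 at an end of a path. *)
Require Import Defs.
From mathcomp Require Import all_boot.
From mathcomp Require Import boolp zify.

Set Implicit Arguments.
Unset Strict Implicit.
Unset Printing Implicit Defensive.

(** * Crossing edges, ordered triples and arithmetic on the cycle *)

Lemma path_enters (T : finType) (e : rel T) (A : pred T) x p :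
  path e x p -> ~~ A x -> A (last x p) ->
  exists u v, [/\ e u v, ~~ A u, A v & u \in x :: p].
Proof.
elim: p x => [|z p IHp] x /=; first by move=> _ /negbTE->.
case/andP=> exz pzp nAx Al; case Az: (A z).
  by exists x, z; split; rewrite ?mem_head.
have [u [v [euv nAu Av pu]]] := IHp z pzp (negbT Az) Al.
by exists u, v; split; rewrite // inE pu orbT.
Qed.

Lemma card_gt2_sorted (T : finType) (f : T -> nat) (S : {set T}) :
  injective f -> 2 < #|S| ->
  exists a b c, [/\ a \in S, b \in S, c \in S & f a < f b < f c].
Proof.
move=> injf /card_gt2P[a [b [c [[aS bS cS] [nab nbc nca]]]]].
have Nf u v : u != v -> f u <> f v by move=> /eqP nuv /injf.
move: (Nf _ _ nab) (Nf _ _ nbc) (Nf _ _ nca) => fab fbc fca.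
(* Of the eight sign patterns, the two cyclic ones are contradictory and the other six are linear
   orders. *)
case: (ltngtP (f a) (f b)) fab => // ab _; case: (ltngtP (f b) (f c)) fbc => // bc _;
  case: (ltngtP (f c) (f a)) fca => // ca _.
- by lia.
- by exists a, b, c; split; rewrite ?ab ?bc.
- by exists c, a, b; split; rewrite ?ab ?ca.
- by exists a, c, b; split; rewrite ?ca ?bc.
- by exists b, c, a; split; rewrite ?ca ?bc.
- by exists b, a, c; split; rewrite ?ca ?ab.
- by exists c, b, a; split; rewrite ?bc ?ab.
- by lia.
Qed.

Lemma val_ordS n (i : 'I_n) : ordS i = (if i.+1 == n then 0 else i.+1) :> nat.
Proof.
rewrite /=; have := ltn_ord i; rewrite leq_eqVlt.
by case: eqP => [-> | _ /modn_small //]; rewrite modnn.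
Qed.

(** Puts adjacency in linear arithmetic with an explicit wrap-around, the form in which [lia] can
    reason about arcs. *)
Lemma cycle_relE n (i j : 'I_n) : cycle_rel i j =
  [|| j == i.+1 :> nat, i == j.+1 :> nat,
      (j == 0 :> nat) && (i.+1 == n) | (i == 0 :> nat) && (j.+1 == n)].
Proof.
have ordE (k m : 'I_n) : (k == m) = (k == m :> nat) by [].
rewrite /cycle_rel !ordE !val_ordS; have := ltn_ord i; have := ltn_ord j.
by do 2 case: ifP; lia.
Qed.

(** * Position sets and bounds on position numbers *)

Section PositionSets.
Variables (T : finType) (e : rel T).
Hypotheses (e_simple : simple_graph e) (e_conn : connected_graph e).

Lemma geodesic_exists x y : exists p, geodesic e x y p.
Proof.
(* Quantifying over tuples of fixed length makes [P] boolean, as [ex_minnP] requires. *)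
pose P n := [exists t : n.-tuple T, is_path_between e x y t].
have exP : exists n, P n.
  have /connectP[p ep] := e_conn.2 x y.
  case: (shortenP ep) => q eq uq _ yE.
  exists (size q); apply/existsP; exists (in_tuple q).
  by rewrite /is_path_between eq uq -yE eqxx.
case: (ex_minnP exP) => n /existsP[t Pt] minn.
exists t; split=> // q Pq; rewrite size_tuple; apply: minn.
by apply/existsP; exists (in_tuple q).
Qed.

Lemma position_set_enter x S (A : pred T) y :
  position_set e x S -> y \in S -> A y -> ~~ A x ->
  exists u v, [/\ e u v, ~~ A u, A v & u \notin S].
Proof.
move=> posS yS Ay nAx; have [p geop] := geodesic_exists x y.
case: (geop) => /and3P[ep _ /eqP lp] _.
have [|u [v [euv nAu Av pu]]] := path_enters ep nAx; first by rewrite lp.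
exists u, v; split=> //; apply/negP=> uS.
have := posS y yS p geop u; rewrite pu in_setD1 uS andbT => /(_ _)/negP.
by apply=> //; apply: contraNneq nAu => ->.
Qed.

(** The source lies on all of its own geodesics, so it shares a position set with no other
    vertex. *)
Lemma position_set_source x S :
  position_set e x S -> x \in S -> S = [set x].
Proof.
move=> posS xS; apply/setP=> y; rewrite inE; apply/idP/eqP=> [yS | ->//].
apply: contraTeq xS => nyx; have [p geop] := geodesic_exists x y.
apply/negP=> xS; have := posS y yS p geop x.
by rewrite in_setD1 xS eq_sym nyx mem_head => /(_ isT).
Qed.

Lemma leq_position_number x S :
  position_set e x S -> #|S| <= position_number e x.
Proof. by move=> /asboolP posS; rewrite (bigmax_sup S). Qed.

Lemma position_number_leq x k :
  0 < k -> (forall S, position_set e x S -> x \notin S -> #|S| <= k) ->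
  position_number e x <= k.
Proof.
move=> k_gt0 le_k; apply/bigmax_leqP=> S /asboolP posS.
have [xS | nxS] := boolP (x \in S); last exact: le_k.
by rewrite (position_set_source posS xS) cards1.
Qed.

(** A geodesic to a neighbour [y] of [x] is a single edge, so it meets no other neighbour. *)
Lemma degree_leq_position_number x : #|[set y | e x y]| <= position_number e x.
Proof.
apply: leq_position_number => y; rewrite inE => exy p [/and3P[_ _ /eqP lp] minp] z.
have nxy : x != y by apply: contraTneq exy => ->; rewrite e_simple.2.
have: size p <= size [:: y].
  by apply: minp; rewrite /is_path_between /= exy inE nxy eqxx.
case: p lp {minp} => [/= xy | w [|//]]; first by rewrite xy eqxx in nxy.
move=> /= -> _; rewrite !inE => /andP[/negbTE-> exz]; rewrite orbF.
by apply: contraTneq exz => ->; rewrite e_simple.2.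
Qed.

Lemma position_number_leq_vp x : position_number e x <= vp e.
Proof. by rewrite /vp (bigmax_sup x). Qed.

Lemma vp_minus_leq x : vp_minus e <= position_number e x.
Proof.
rewrite /vp_minus; elim: (index_enum T) (mem_index_enum x) => // y s IHs.
rewrite inE big_cons geq_min => /predU1P[-> | /IHs->]; first by rewrite leqnn.
by rewrite orbT.
Qed.

(** A position set is either the singleton of its source or misses its source. This is what yields
    three vertices when [vp e = 2]. *)
Lemma vp_leq_card : vp e <= maxn 1 #|T|.-1.
Proof.
apply/bigmax_leqP=> x _; apply: position_number_leq => [|S _ xS]; first by lia.
have : #|x |: S| <= #|T| by apply: max_card.
by rewrite cardsU1 xS; lia.
Qed.

Lemma vp2_degree x a b c : vp e = 2 ->
  e x a -> e x b -> e x c -> [|| a == b, b == c | c == a].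
Proof.
move=> vp2 exa exb exc; rewrite -[_ || _]negbK !negb_or.
apply/negP=> /and3P[nab nbc nca].
have := leq_trans (degree_leq_position_number x) (position_number_leq_vp x).
rewrite vp2 leqNgt => /negP[]; apply/card_gt2P.
by exists a, b, c; rewrite !inE.
Qed.

(** * Connected graphs of maximum degree at most two *)

Section DegreeTwo.
Hypothesis degree2 : forall x a b c,
  e x a -> e x b -> e x c -> [|| a == b, b == c | c == a].

Lemma longest_path_exists : exists s : seq T,
  [/\ 0 < size s, sorted e s, uniq s &
      forall t, sorted e t -> uniq t -> size t <= size s].
Proof.
pose P n := [exists t : n.-tuple T, sorted e t && uniq t].
have [x0 _] := card_gt0P e_conn.1.
have P1 : P 1 by apply/existsP; exists [tuple x0].
have Pmax n : P n -> n <= #|T|.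
  by case/existsP=> t /andP[_ /card_uniqP]; rewrite size_tuple => <-; exact: max_card.
case: (ex_maxnP (ex_intro P 1 P1) Pmax) => n /existsP[t /andP[st ut]] maxn.
exists t; split=> //; rewrite size_tuple; first exact: maxn.
by move=> q sq uq; apply: maxn; apply/existsP; exists (in_tuple q); rewrite sq.
Qed.

(** If a vertex were missed, some edge from [u] to [v] would leave the path. It prolongs the path
    when [u] is an end, and gives [u] a third neighbour otherwise. *)
Lemma longest_path_spans s : 0 < size s -> sorted e s -> uniq s ->
  (forall t, sorted e t -> uniq t -> size t <= size s) -> forall y, y \in s.
Proof.
move=> s_gt0 sp us maxp y; apply/negPn/negP=> ny.
have [x [p sE]] : exists x p, s = x :: p by case: s s_gt0 {sp us maxp ny} => // x p; exists x, p.
have /connectP[q eq lq] := e_conn.2 x y.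
have [||u [v [euv]]] := path_enters (A := [pred z | z \notin s]) eq.
- by rewrite /= negbK sE mem_head.
- by rewrite /= -lq.
rewrite /= negbK => uins vs _; have esym := e_simple.1.
have /(sortedP x) es := sp.
have := uins; rewrite -index_mem => ui; have := nth_index x uins.
set i := index u s in ui * => ei.
have [i0 | i_gt0] := posnP i.
  suff /maxp : sorted e (v :: s) by rewrite /= vs us ltnn => /(_ isT).
  move: sp ei; rewrite i0 sE /= => -> ->; by rewrite esym euv.
have [iS | iS] := leqP (size s) i.+1.
  suff /maxp : sorted e (rcons s v) by rewrite size_rcons rcons_uniq vs us ltnn => /(_ isT).
  move: sp; rewrite sE /= rcons_path => ->; rewrite (last_nth x) -sE.
  by rewrite (_ : size p = i) ?ei //; move: ui iS; rewrite sE /=; lia.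
have e1 : e u (nth x s i.-1).
  by rewrite esym -ei; have := es i.-1; rewrite prednK //; apply; exact: ltnW.
have e2 : e u (nth x s i.+1) by rewrite -ei; exact: es.
have i1 : i.-1 < size s by rewrite (leq_trans _ ui) // ltnS leq_pred.
case/or3P: (degree2 e1 e2 euv).
- by rewrite nth_uniq //; lia.
- by move/eqP=> ev; rewrite -ev mem_nth in vs.
- by move/eqP=> ev; rewrite ev mem_nth in vs.
Qed.

(** An interior vertex already has two neighbours along the path, and a chord would add a third. *)
Lemma spanning_path_chord (s : seq T) x0 i j : sorted e s -> uniq s ->
  i < j < size s -> e (nth x0 s i) (nth x0 s j) ->
  (j == i.+1) || (i == 0) && (j == (size s).-1).
Proof.
move=> /(sortedP x0) es us /andP[ij js] eij; have esym := e_simple.1.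
have ns := fun a b (ha : a < size s) (hb : b < size s) => nth_uniq x0 ha hb us.
have [//|nj] := eqVneq j i.+1; rewrite /=; apply/andP; split; apply/contraT.
  case: i => // i in ij eij nj * => _.
  have e1 : e (nth x0 s i.+1) (nth x0 s i) by rewrite esym es //; lia.
  have e2 : e (nth x0 s i.+1) (nth x0 s i.+2) by apply: es; lia.
  by move: (degree2 e1 e2 eij); rewrite !ns; lia.
move=> jl; case: j => // j in ij js eij nj jl *.
have e1 : e (nth x0 s j.+1) (nth x0 s j) by rewrite esym es //; lia.
have e2 : e (nth x0 s j.+1) (nth x0 s j.+2) by apply: es; lia.
have e3 : e (nth x0 s j.+1) (nth x0 s i) by rewrite esym.
by move: (degree2 e1 e2 e3); rewrite !ns; lia.
Qed.

Lemma graph_iso_enum x0 (s : seq T) (d : rel 'I_(size s)) :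
  uniq s -> (forall y, y \in s) ->
  (forall i j, d i j = e (nth x0 s i) (nth x0 s j)) -> graph_iso e d.
Proof.
move=> us alls de.
have lt_index y : index y s < size s by rewrite index_mem.
exists (fun y => Ordinal (lt_index y)); last first.
  by move=> x y; rewrite de /= !nth_index.
exists (fun i : 'I_(size s) => nth x0 s i) => [y | i]; first exact: nth_index.
by apply: val_inj; rewrite /= index_uniq.
Qed.

Lemma degree2_cycle_or_path : 2 < #|T| ->
  is_cycle e \/ exists2 l, 2 <= l & is_path_of_length e l.
Proof.
move=> T_gt2; have [s [s_gt0 ss us maxs]] := longest_path_exists.
have alls := longest_path_spans s_gt0 ss us maxs.
have szs : size s = #|T|.
  by rewrite -(card_uniqP us); apply: eq_card => y; rewrite alls.
have esym := e_simple.1; have eirr := e_simple.2.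
have [x _] := card_gt0P e_conn.1; have /(sortedP x) es := ss.
(* Whether the two ends are adjacent decides between a cycle and a path. *)
pose c := e (nth x s 0) (nth x s (size s).-1).
have edge (i j : 'I_(size s)) : e (nth x s i) (nth x s j) =
    [|| j == i.+1 :> nat, i == j.+1 :> nat,
        [&& i == 0 :> nat, j == (size s).-1 :> nat & c] |
        [&& j == 0 :> nat, i == (size s).-1 :> nat & c]].
  wlog ij : i j / i <= j.
    have [ij | /ltnW ji] := leqP i j => [/(_ i j ij)//| /(_ j i ji) ej].
    by rewrite esym ej orbCA; congr [|| _, _ | _]; exact: orbC.
  have := ltn_ord j; case: (ltngtP i j) ij => // [ij _ js | /val_inj-> _ _]; last first.
    (* On the diagonal the clause on the two ends could hold only for a one-vertex path, which
       [T_gt2] excludes. *)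
    by rewrite eirr; lia.
  apply/idP/idP => [eij|].
    have := spanning_path_chord ss us (introT andP (conj ij js)) eij.
    case/orP=> [-> // | /andP[/eqP i0 /eqP jl]].
    by move: eij; rewrite i0 jl -/c => ->; rewrite !eqxx !orbT.
  case/or4P => [/eqP jE | ||].
  - by rewrite jE; apply: es; rewrite -jE.
  - by lia.
  - by case/and3P=> /eqP-> /eqP->.
  - by lia.
have [cT | cF] := boolP c; [left | right].
  exists (size s); first by rewrite szs.
  apply: (graph_iso_enum (x0 := x) us alls) => i j; rewrite edge cycle_relE cT.
  by have := ltn_ord i; have := ltn_ord j; lia.
(* [path_rel] lives on ['I_l.+1], so the size of [s] must be exposed as a successor. *)
case: s => [//|z p] in s_gt0 ss us maxs alls szs es c edge cF *.
exists (size p); first by rewrite -ltnS -[(size p).+1]/(size (z :: p)) szs.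
apply: (@graph_iso_enum x (z :: p) (@path_rel _) us alls) => i j.
by rewrite edge (negbTE cF) !andbF !orbF.
Qed.

End DegreeTwo.

(** * Position numbers of paths and cycles *)

Lemma path_end_position_number l : is_path_of_length e l ->
  exists x, position_number e x <= 1.
Proof.
case=> f [g fK gK] fe; exists (g ord0).
apply: position_number_leq => // S posS xS; rewrite leqNgt; apply/negP=> /card_gt1P.
case=> a [b [aS bS nab]].
wlog ab : a b aS bS nab / f a < f b => [wl|].
  case: (ltngtP (f a) (f b)) => [|| /val_inj/(can_inj fK) Eab]; first exact: wl.
    by apply: wl => //; rewrite eq_sym.
  by rewrite Eab eqxx in nab.
(* Every edge entering the vertices beyond [a] starts at [a], which belongs to [S]. *)
have [||u [v []]] := position_set_enter (A := [pred y | f a < f y]) posS bS.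
- by [].
- by rewrite /= gK ltn0.
rewrite -fe /path_rel /= => euv nu v_gt; apply/negP; rewrite negbK.
suff -> : u = a by [].
by apply/(can_inj fK)/val_inj; move: euv nu v_gt => /=; lia.
Qed.

(** Three elements of [S] cut the cycle into three open arcs, one of which contains [x]. The
    complementary open arc, between the same two ends, contains the third element and can be entered
    only from these ends, both in [S]. *)
Lemma cycle_position_number_leq x : is_cycle e -> position_number e x <= 2.
Proof.
case=> n n_ge3 [f [g fK gK] fe].
apply: position_number_leq => // S posS xS; rewrite leqNgt; apply/negP.
have injf : injective (fun y => f y : nat) by move=> y z /val_inj/(can_inj fK).
move=> /(card_gt2_sorted injf)[a [b [c [aS bS cS /andP[ab bc]]]]].
have nf y : y \in S -> f x <> f y :> nat by move=> yS /injf xy; rewrite xy yS in xS.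
have fc_lt := ltn_ord (f c).
have [xa xb xc] := And3 (nf a aS) (nf b bS) (nf c cS).
have inS u w : u \notin S -> w \in S -> f u <> f w :> nat.
  by move=> uS wS /injf uw; rewrite uw wS in uS.
have sep (A : pred nat) y : y \in S -> A (f y) -> ~~ A (f x) ->
    exists u v, [/\ cycle_rel (f u) (f v), ~~ A (f u), A (f v) &
                    [/\ f u <> f a :> nat, f u <> f b :> nat & f u <> f c :> nat]].
  move=> yS Ay nAx.
  have [u [v [euv nAu Av uS]]] := position_set_enter (A := [pred z | A (f z)]) posS yS Ay nAx.
  by exists u, v; rewrite fe; split=> //; split; apply: inS.
(* If [x] is not between [a] and [c], its arc is the one that wraps around, and the set to enter is
   an interval around [b]. *)
have [xin | xout] := boolP (f a < f x < f c); last first.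
  have [||u [v [+ + + []]]] := sep [pred i | f a < i < f c] b bS.
  - by rewrite /= ab bc.
  - exact: xout.
  by rewrite cycle_relE /=; lia.
(* Here [x] lies strictly between two consecutive elements, and the set to enter wraps around. *)
have [xltb | bltx] := ltnP (f x) (f b).
  have [||u [v [+ + + []]]] := sep [pred i | (i < f a) || (f b < i)] c cS.
  - by rewrite /= bc orbT.
  - by rewrite /=; lia.
  by rewrite cycle_relE /=; lia.
have [||u [v [+ + + []]]] := sep [pred i | (i < f b) || (f c < i)] a aS.
- by rewrite /= ab.
- by rewrite /=; lia.
by rewrite cycle_relE /=; lia.
Qed.

Lemma cycle_position_number_geq x : is_cycle e -> 2 <= position_number e x.
Proof.
case=> n n_ge3 [f [g fK gK] fe].
apply: leq_trans (degree_leq_position_number x); apply/card_gt1P.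
exists (g (ordS (f x))), (g (ord_pred (f x))); rewrite !inE -!fe !gK.
rewrite /cycle_rel ord_predK !eqxx orbT; split=> //.
(* If the successor and the predecessor agreed, two steps would lead back to the start, impossible
   since [n >= 3]. *)
apply/eqP=> /(can_inj gK) /(congr1 (@ordS n)); rewrite ord_predK => /(congr1 (@nat_of_ord n)).
by rewrite !val_ordS; have := ltn_ord (f x); do 2 case: ifP; lia.
Qed.

Lemma cycle_vp : is_cycle e -> vp_minus e = 2 /\ vp e = 2.
Proof.
move=> cyc; have [x0 _] := card_gt0P e_conn.1.
have pn x : position_number e x = 2.
  by apply/eqP; rewrite eqn_leq cycle_position_number_leq ?cycle_position_number_geq.
(* The default value [#|T|] of the iterated minimum must also satisfy the lower bound. *)
have T_ge2 : 2 <= #|T|.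
  rewrite -(pn x0); apply: position_number_leq => [|S _ _]; last exact: max_card.
  exact: e_conn.1.
split; apply/eqP; rewrite eqn_leq.
  rewrite -{1}(pn x0) vp_minus_leq /=.
  apply: (big_ind (fun m => 2 <= m)) => // [m k m2 k2|x _].
    by rewrite leq_min m2.
  by rewrite pn.
by rewrite -{2}(pn x0) position_number_leq_vp andbT; apply/bigmax_leqP=> x _; rewrite pn.
Qed.

Lemma vp2_cycle_or_path : vp e = 2 ->
  is_cycle e \/ exists2 l, 2 <= l & is_path_of_length e l.
Proof.
move=> vp2; apply: degree2_cycle_or_path => [x a b c|]; first exact: vp2_degree.
by have := vp_leq_card; rewrite vp2; lia.
Qed.

End PositionSets.

Theorem corollary4p2 (T : finType) (e : rel T)
    (e_simple : simple_graph e) (e_conn : connected_graph e) :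
  ((vp_minus e = 2 /\ vp e = 2) <-> is_cycle e) /\
  (vp e = 2 -> is_cycle e \/ exists2 l, 2 <= l & is_path_of_length e l).
Proof.
split; last exact: vp2_cycle_or_path.
split=> [[vpm2 vp2] | ]; last exact: cycle_vp.
have [// | [l _ pathl]] := vp2_cycle_or_path e_simple e_conn vp2.
(* An end of a path would force [vp_minus e] to be at most 1. *)
have [x] := path_end_position_number e_conn pathl.
by rewrite leqNgt -vpm2 vp_minus_leq.
Qed.
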